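(* Let $\mathfrak g=\mathfrak{su}(2)$ and let $g$ be the pseudo-metric on the hypersymplectic leaves of $M_o$ described in the context. Let $X$ be the gradient vector field of $\Phi$, i.e. $X=([b,c],[c,a],[a,b])$ at $(a,b,c)\in M_o$ (which is tangent to the leaves). Then $$g(X,X)=-\Phi.$$
   Context: $\mathfrak g=\mathfrak{su}(2)$ carries an Ad-invariant positive-definite inner product $\langle\cdot,\cdot\rangle$ (a multiple of the Killing form), used to identify $\mathfrak g^*$ with $\mathfrak g$. $M=L(\mathfrak g,\mathfrak{su}(2))$ is the space of linear maps, where the target is regarded as an oriented Euclidean space. A frame is an orthonormal basis $\mathcal F=\{e_1,e_2,e_3\}$ of the target (of a fixed orientation); $\mathcal F_1=\mathcal F$, $\mathcal F_2=\{e_2,e_3,e_1\}$, $\mathcal F_3=\{e_3,e_1,e_2\}$. It identifies $M$ with $\mathfrak g\times\mathfrak g\times\mathfrak g$ via $\Psi_{\mathcal F}:\phi\mapsto(a,b,c)$, $\phi(x)=\langle a,x\rangle e_1+\langle b,x\rangle e_2+\langle c,x\rangle e_3$. $\Phi(a,b,c)=\langle a,[b,c]\rangle$, $M_o=\{\Phi\neq0\}$, and on $M_o$ $$A(a,b,c)=\frac1{\Phi}\big([a,b]\otimes[a,b]+[b,c]\otimes[b,c]+[c,a]\otimes[c,a]\big)\in S^2(\mathfrak g),$$ with $A_{\xi,\eta}$ its contraction with $\xi,\eta\in\mathfrak g$ (both $\Phi$ and $A$ are independent of the frame). With $l^1_\xi(a,b,c)=\langle\xi,a\rangle$, $l^2_\xi(a,b,c)=\langle\xi,b\rangle$,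 $l^3_\xi(a,b,c)=\langle\xi,c\rangle$, $\pi_{\mathcal F}$ is the Poisson structure on $M_o$ whose bracket $\{f,g\}=\pi_{\mathcal F}(df,dg)$, under $\Psi_{\mathcal F}$, is $$\{l^1_\xi,l^1_\eta\}=l^1_{[\xi,\eta]},\quad \{l^1_\xi,l^2_\eta\}=\{l^2_\xi,l^1_\eta\}=l^2_{[\xi,\eta]},\quad \{l^2_\xi,l^2_\eta\}=-l^1_{[\xi,\eta]},$$ $$\{l^1_\xi,l^3_\eta\}=\{l^3_\xi,l^1_\eta\}=l^3_{[\xi,\eta]},\quad \{l^3_\xi,l^3_\eta\}=-l^1_{[\xi,\eta]},\quad \{l^2_\xi,l^3_\eta\}=-\{l^3_\xi,l^2_\eta\}=A_{\xi,\eta}.$$ The symplectic leaves of $\pi_{\mathcal F_1},\pi_{\mathcal F_2},\pi_{\mathcal F_3}$ coincide (hypersymplectic leaves). On a leaf let $\omega_i$ be the symplectic form induced by $\pi_{\mathcal F_i}$, with bundle map $\omega_i^b:v\mapsto\omega_i(v,\cdot)$, where the convention is that $(\omega_i^b)^{-1}(df)=X^i_f$ is the vector field with $X^i_fh=\{f,h\}_{\mathcal F_i}$. The pseudo-metric is $g=\omega_3^b(\omega_1^b)^{-1}\omega_2^b:TS\to T^*S$, $g(u,v)=\langle g(u),v\rangle$; it is symmetric and independent of the frame of the fixed orientation. *)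

(* Defs.v *)
From HB Require Import structures.
From mathcomp Require Import all_boot all_order all_algebra.
From mathcomp Require Import sesquilinear.
From mathcomp Require Import complex.
From mathcomp Require Import reals topology normedtype derive.

Set Implicit Arguments.
Unset Strict Implicit.
Unset Printing Implicit Defensive.

Import Order.TTheory GRing.Theory Num.Theory.
Import numFieldNormedType.Exports.

Local Open Scope ring_scope.
Local Open Scope complex_scope.

(* Conjugate transpose. *)
Definition ctr (R : realType) n (x : 'M[R[i]]_n) : 'M[R[i]]_n := map_mx conjc x^T.

(* su(2): traceless skew-Hermitian 2x2 complex matrices, as a real vector space. *)
Definition su2_pred {R : realType} : {pred 'M[R[i]]_2} :=
  fun x => (ctr x == - x) && (\tr x == 0).

Record su2 (R : realType) := Su2 {
  su2val :> 'M[R[i]]_2;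
  su2P : su2val \in su2_pred }.

Section Su2Structure.
Variable R : realType.

HB.instance Definition _ := [isSub of su2 R for @su2val R].
HB.instance Definition _ := [Choice of su2 R by <:].

Fact ctrD n : {morph @ctr R n : x y / x + y}.
Proof. by move=> x y; rewrite /ctr linearD map_mxD. Qed.
Fact ctrN n : {morph @ctr R n : x / - x}.
Proof. by move=> x; rewrite /ctr linearN map_mxN. Qed.
Fact ctrM n (x y : 'M[R[i]]_n) : ctr (x *m y) = ctr y *m ctr x.
Proof. by rewrite /ctr trmx_mul map_mxM. Qed.

Fact su2_zmod : zmod_closed (@su2_pred R).
Proof.
split=> [|x y]; rewrite !unfold_in.
  by rewrite /ctr trmx0 map_mx0 oppr0 mxtrace0 !eqxx.
move=> /andP[/eqP hx /eqP tx] /andP[/eqP hy /eqP ty].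
by rewrite ctrD ctrN hx hy opprD eqxx linearB /= tx ty subr0 eqxx.
Qed.
HB.instance Definition _ :=
  GRing.isZmodClosed.Build 'M[R[i]]_2 (@su2_pred R) su2_zmod.
HB.instance Definition _ := [SubChoice_isSubZmodule of su2 R by <:].

Fact su2_scale (r : R) (x : su2 R) : r%:C *: su2val x \in su2_pred.
Proof.
have := su2P x; rewrite !unfold_in => /andP[/eqP hx /eqP tx].
have -> : ctr (r%:C *: su2val x) = r%:C *: ctr x.
  by apply/matrixP => i j; rewrite !mxE rmorphM /= oppr0.
by rewrite hx mxtraceZ tx mulr0 scalerN !eqxx.
Qed.
Definition scale_su2 r x := Su2 (su2_scale r x).

Fact scale_su2A a b x : scale_su2 a (scale_su2 b x) = scale_su2 (a * b) x.
Proof. by apply/val_inj; rewrite /= scalerA -rmorphM. Qed.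
Fact scale_su21 : left_id 1 scale_su2.
Proof. by move=> x; apply/val_inj; rewrite /= scale1r. Qed.
Fact scale_su2Dr : right_distributive scale_su2 +%R.
Proof. by move=> a x y; apply/val_inj; rewrite /= scalerDr. Qed.
Fact scale_su2Dl x : {morph scale_su2^~ x : a b / a + b}.
Proof. by move=> a b; apply/val_inj; rewrite /= rmorphD scalerDl. Qed.
HB.instance Definition _ := GRing.Zmodule_isLmodule.Build R (su2 R)
  scale_su2A scale_su21 scale_su2Dr scale_su2Dl.

(* Coordinates: [[i a, b + i c], [- b + i c, - i a]]. *)
Definition su2_mx (v : 'rV[R]_3) : 'M[R[i]]_2 :=
  \matrix_(i, j)
    if i == 0 then (if j == 0 then 0 +i* v 0 0 else v 0 1 +i* v 0 2%:R)
    else (if j == 0 then - v 0 1 +i* v 0 2%:R else 0 -i* v 0 0).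

Fact su2_mxP v : su2_mx v \in su2_pred.
Proof.
rewrite unfold_in; apply/andP; split; last first.
  by rewrite /mxtrace !big_ord_recl big_ord0 !mxE /= addr0 eq_complex /= addr0 subrr !eqxx.
apply/eqP/matrixP => i j; rewrite !mxE.
by case: i => -[|[|//]] ?; case: j => -[|[|//]] ?; apply/eqP;
  rewrite eq_complex /= ?oppr0 ?opprK !eqxx.
Qed.

Definition su2_to_row (x : su2 R) : 'rV[R]_3 :=
  \row_k if k == 0 then complex.Im (su2val x 0 0)
         else if k == 1 then complex.Re (su2val x 0 1) else complex.Im (su2val x 0 1).

Fact su2_vect_iso : Vector.axiom 3 (su2 R).
Proof.
exists su2_to_row => [r x y|].
  apply/rowP => k; rewrite !mxE /=.
  case: (su2val x 0 0) (su2val x 0 1) => [x1 x2] [x3 x4].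
  case: (su2val y 0 0) (su2val y 0 1) => [y1 y2] [y3 y4] /=.
  by case: ifP => _; [|case: ifP => _]; rewrite /= !mul0r ?addr0 ?subr0.
exists (fun v => Su2 (su2_mxP v)) => [x|v].
  apply/val_inj/matrixP => i j /=.
  have := su2P x; rewrite unfold_in => /andP[/eqP/matrixP hx /eqP tx].
  have h00 := hx 0 0; have h01 := hx 1 0.
  move: tx; rewrite /mxtrace !big_ord_recl big_ord0 addr0 => tx.
  have {}tx : su2val x 1 1 = - su2val x 0 0.
    apply/eqP; rewrite -addr_eq0 addrC; apply/eqP; rewrite -[RHS]tx.
    by congr (_ + su2val x _ _); apply: val_inj.
  have i01 (k : 'I_2) : k = 0 \/ k = 1.
    by case: k => -[|[|//]] ?; [left|right]; apply: val_inj.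
  rewrite !mxE in h00 h01 *.
  move: h00 h01 tx.
  case: (i01 i) => ->; case: (i01 j) => -> /=;
  case: (su2val x 0 0) (su2val x 0 1) (su2val x 1 0) (su2val x 1 1)
    => [x1 x2] [x3 x4] [x5 x6] [x7 x8] /=;
  move=> /eqP; rewrite eq_complex /= => /andP[/eqP h1 _];
  move=> /eqP; rewrite eq_complex /= => /andP[/eqP h2 /eqP h3];
  move=> /eqP; rewrite eq_complex /= => /andP[/eqP h4 /eqP h5];
  have hx1 : x1 = 0 by
    apply/eqP; rewrite -[_ == _](mulrn_eq0 x1 2) mulr2n {1}h1 addNr eqxx.
  - by rewrite hx1.
  - by [].
  - by rewrite h2 opprK -[x4]opprK h3 opprK.
  - by rewrite h4 h5 hx1 oppr0.
apply/rowP => -[[|[|[|//]]] hk]; rewrite !mxE /=; congr (v _ _); exact: val_inj.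
Qed.
HB.instance Definition _ := Lmodule_hasFinDim.Build R (su2 R) su2_vect_iso.
End Su2Structure.

Section LieAlgebra.
Variable R : realType.

Fact lie_su2P (x y : su2 R) :
  su2val x *m su2val y - su2val y *m su2val x \in su2_pred.
Proof.
have := su2P x; have := su2P y; rewrite !unfold_in.
move=> /andP[/eqP hy _] /andP[/eqP hx _]; apply/andP; split.
  by rewrite ctrD ctrN !ctrM hx hy !mulmxN !mulNmx !opprK opprB.
by rewrite linearB /= mxtrace_mulC subrr.
Qed.

Definition lie (x y : su2 R) : su2 R := Su2 (lie_su2P x y).

Definition SU2 : {pred 'M[R[i]]_2} :=
  fun u => (u *m ctr u == 1%:M) && (\det u == 1).

Fact Ad_su2P (u : 'M[R[i]]_2) (hu : u \in SU2) (x : su2 R) :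
  u *m su2val x *m ctr u \in su2_pred.
Proof.
move: hu (su2P x); rewrite !unfold_in => /andP[/eqP hu _] /andP[/eqP hx /eqP tx].
have ctrK : ctr (ctr u) = u by apply/matrixP => i j; rewrite !mxE conjcK.
apply/andP; split.
  by rewrite !ctrM ctrK hx mulmxA mulmxN mulNmx.
by rewrite mxtrace_mulC mulmxA (mulmx1C hu) mul1mx tx.
Qed.

(* For u in SU(2) the inverse of u is its conjugate transpose. *)
Definition Ad (u : 'M[R[i]]_2) (hu : u \in SU2) (x : su2 R) : su2 R :=
  Su2 (Ad_su2P hu x).

(* [{dot su2 R for idfun}]: positive definite symmetric bilinear forms. *)
Definition Ad_invariant (ip : {dot su2 R for idfun}) : Prop :=
  forall (u : 'M[R[i]]_2) (hu : u \in SU2) (x y : su2 R),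
    ip (Ad hu x) (Ad hu y) = ip x y.

End LieAlgebra.

Section LinearDuality.
Variable R : realType.

Definition dual (V : vectType R) : vectType R := 'Hom(V, R^o).

(* [linfun f] is the linear map with underlying function f, for f linear. *)
Definition bidual_ev (V : vectType R) : 'Hom(V, dual (dual V)) :=
  linfun (fun v => linfun (fun alpha : dual V => alpha v)).
End LinearDuality.

Section HyperPoisson.
Variable R : realType.
Local Notation g := (su2 R).

Definition Mspace : vectType R := 'Hom(g, g).
Definition g3 : vectType R := {ffun 'I_3 -> g}.

(* ip: on the Lie algebra g; ipT: on the target of the linear maps. *)
Variables ip ipT : {dot g for idfun}.

Definition Phi3 (w : g3) : R := ip (w 0) (lie (w 1) (w 2%:R)).

Definition A3 (w : g3) (xi eta : g) : R :=
  let a := w 0 in let b := w 1 in let c := w 2%:R in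
  (Phi3 w)^-1 * (ip (lie a b) xi * ip (lie a b) eta
               + ip (lie b c) xi * ip (lie b c) eta
               + ip (lie c a) xi * ip (lie c a) eta).

Section Frame.
Variable F : 3.-tuple g.

Definition PsiV : 'Hom(g3, Mspace) :=
  linfun (fun w : g3 =>
    linfun (fun x : g => \sum_(k < 3) ip (w k) x *: tnth F k) : Mspace).

(* For a frame F, PsiV is bijective and Psi is its inverse. *)
Definition Psi : 'Hom(Mspace, g3) := (PsiV^-1)%VF.

Definition Phi (p : Mspace) : R := Phi3 (Psi p).

(* l^(i+1)_xi: indices are 0-based, a point (a, b, c) being (w 0, w 1, w 2). *)
Definition lcoord (i : 'I_3) (xi : g) : dual Mspace :=
  linfun (fun p : Mspace => ip xi (Psi p i) : R^o).

Definition bracket_lcoord (p : Mspace) (i j : 'I_3) (xi eta : g) : R :=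
  match val i, val j with
  | 0%N, 0%N => lcoord 0 (lie xi eta) p
  | 0%N, 1%N | 1%N, 0%N => lcoord 1 (lie xi eta) p
  | 0%N, 2%N | 2%N, 0%N => lcoord 2%:R (lie xi eta) p
  | 1%N, 2%N => A3 (Psi p) xi eta
  | 2%N, 1%N => - A3 (Psi p) xi eta
  | _, _ => - lcoord 0 (lie xi eta) p
  end.

(* (xi_0, xi_1, xi_2) |-> the sum of the l^i_(xi_i); an isomorphism for a frame F. *)
Definition covector : 'Hom(g3, dual Mspace) :=
  linfun (fun z : g3 => \sum_(i < 3) lcoord i (z i)).

(* The bivector at p with poisson p (l^i_xi) (l^j_eta) = {l^i_xi, l^j_eta}(p). The
   cotangent space at p is [dual Mspace]; a linear function is its own differential. *)
Definition poisson (p : Mspace) (alpha beta : dual Mspace) : R :=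
  let z := (covector^-1)%VF alpha in let z' := (covector^-1)%VF beta in
  \sum_(i < 3) \sum_(j < 3) bracket_lcoord p i j (z i) (z' j).

(* alpha |-> the vector v with beta v = poisson p alpha beta for all beta;
   thus sharp (df) is the Hamiltonian vector X_f at p. *)
Definition sharp (p : Mspace) : 'Hom(dual Mspace, Mspace) :=
  ((bidual_ev Mspace)^-1 \o
   linfun (fun alpha => linfun (poisson p alpha : dual Mspace -> R^o)))%VF.

(* The tangent space at p of the symplectic leaf through p: the leaves are the
   integral manifolds of the distribution spanned by the Hamiltonian vectors. *)
Definition leafT (p : Mspace) : {vspace Mspace} := limg (sharp p).

(* The bundle map of the symplectic form of the leaf, T being its tangent space: it
   sends sharp alpha to the restriction of alpha to T, so that its inverse sends df
   to X_f. The choice of a preimage under sharp is immaterial, as every covector in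
   the kernel of sharp vanishes on the image of sharp. *)
Definition omega_flat (p : Mspace) (T : {vspace Mspace}) :
    'Hom(subvs_of T, dual (subvs_of T)) :=
  linfun (fun u : subvs_of T =>
    linfun (fun v : subvs_of T => (sharp p)^-1%VF (vsval u) (vsval v) : R^o)
      : dual (subvs_of T)).

End Frame.

(* The frames F_1, F_2, F_3 are F and its rotations by 1 and 2; their brackets have
   the same leaves, whence the same T. *)
Definition hflat (F : 3.-tuple g) (p : Mspace) :
    'Hom(subvs_of (leafT F p), dual (subvs_of (leafT F p))) :=
  let omega F' := omega_flat F' p (leafT F p) in
  (omega [tuple of rot 2 F] \o (omega F)^-1 \o omega [tuple of rot 1 F])%VF.

(* Meaningful for u, v tangent to the leaf. *)
Definition hmetric (F : 3.-tuple g) (p u v : Mspace) : R :=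
  hflat F p (vsproj _ u) (vsproj _ v).

(* The Euclidean inner product of Mspace, used for gradients. *)
Definition Mdot (F : 3.-tuple g) (u v : Mspace) : R :=
  \sum_(k < 3) ip (Psi F u k) (Psi F v k).

Definition is_gradient (F : 3.-tuple g) (p X : Mspace) : Prop :=
  forall v : Mspace,
    is_derive (0 : R) (1 : R) (fun t : R => Phi F (p + t *: v)) (Mdot F X v).

Definition Xfield (F : 3.-tuple g) (p : Mspace) : Mspace :=
  let w := Psi F p in
  let a := w 0 in let b := w 1 in let c := w 2%:R in
  PsiV F [ffun k : 'I_3 =>
    if k == 0 then lie b c else if k == 1 then lie c a else lie a b].

(* The basis o represents the orientation of the target. *)
Definition is_frame (o F : 3.-tuple g) : Prop :=
  orthonormal ipT F /\ 0 < \det (\matrix_(i, j) coord o j (tnth F i)).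

End HyperPoisson.

(* Main.v *)
Require Import Defs.
From HB Require Import structures.
From mathcomp Require Import all_boot all_order all_algebra.
From mathcomp Require Import sesquilinear complex.
From mathcomp Require Import boolp reals topology normedtype derive.
From mathcomp Require Import ring lra.

Set Implicit Arguments.
Unset Strict Implicit.
Unset Printing Implicit Defensive.

Import Order.TTheory GRing.Theory Num.Theory.
Import numFieldNormedType.Exports.
Local Open Scope ring_scope.

(* Write u = [b, c], v = [c, a], w = [a, b], identify covectors with triples
   (z0, z1, z2) through the inner product, and let sharp_i be the bundle map of the
   Poisson structure of the i-th frame. The values of sharp_1 are exactly the triples
     (n0 u + n1 v + n2 w, - n1 u + n0 v - t w, - n2 u + t v + n0 w),
   a shape invariant under rotation of the frame, so that the three leaves agree. Then
     X = (u, v, w) = sharp_2 (- c / 2, 0, a / 2),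
     sharp_1 (- c / 2, 0, a / 2) = (v, - u, 0) = sharp_3 (- a / 2, - b / 2, 0),
   and pairing the last covector with X gives
     g(X, X) = - (<a, u> + <b, v>) / 2 = - Phi. *)

Lemma linfunE (R : comNzRingType) (U V : vectType R) (f : U -> V) :
  linear f -> linfun f =1 f.
Proof.
move=> fL; pose m := GRing.isLinear.Build _ _ _ _ f fL.
by pose ff : {linear U -> V} := HB.pack f m; move=> x; rewrite -[RHS](lfunE ff).
Qed.

Lemma ord2_cases (k : 'I_2) : k = 0 \/ k = 1.
Proof. by case: k => -[|[|//]] ?; [left|right]; apply: val_inj. Qed.

Lemma lift_ord2_0 : lift ord0 ord0 = 1 :> 'I_2.
Proof. exact: val_inj. Qed.

(** * Coordinates on su(2) and the classification of its invariant inner products *)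

Section Coordinates.
Variable R : realType.
Local Notation g := (su2 R).
Implicit Types x y z : g.

Definition crd x (k : 'I_3) : R := su2_to_row x 0 k.
Definition su2_of (v : 'rV[R]_3) : g := Su2 (su2_mxP v).

Lemma crdE x : (crd x 0 = complex.Im (su2val x 0 0)) *
  (crd x 1 = complex.Re (su2val x 0 1)) * (crd x 2%:R = complex.Im (su2val x 0 1)).
Proof. by rewrite /crd !mxE. Qed.

Lemma crdD x y k : crd (x + y) k = crd x k + crd y k.
Proof.
rewrite /crd !mxE /= !raddfD.
by case: ifP => // _; case: ifP.
Qed.

Lemma crdN x k : crd (- x) k = - crd x k.
Proof.
rewrite /crd !mxE /= !raddfN.
by case: ifP => // _; case: ifP.
Qed.

Lemma crdZ r x k : crd (r *: x) k = r * crd x k.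
Proof.
rewrite /crd !mxE /=.
case: (su2val x 0 0) (su2val x 0 1) => [x1 x2] [x3 x4] /=.
by case: ifP => _; [|case: ifP => _]; rewrite /= !mul0r ?addr0 ?subr0.
Qed.

Lemma su2_entries x : [/\ su2val x 0 0 = Complex 0 (crd x 0),
  su2val x 0 1 = Complex (crd x 1) (crd x 2%:R),
  su2val x 1 0 = Complex (- crd x 1) (crd x 2%:R)
  & su2val x 1 1 = Complex 0 (- crd x 0)].
Proof.
rewrite !crdE.
have := su2P x; rewrite unfold_in => /andP[/eqP/matrixP hx /eqP].
rewrite /mxtrace !big_ord_recl big_ord0 addr0.
rewrite lift_ord2_0; move=> /eqP; rewrite addrC addr_eq0 => /eqP tx.
move: (hx 0 0) (hx 1 0); rewrite tx !mxE.
case: (su2val x 0 0) (su2val x 0 1) (su2val x 1 0) => [p q] [r s] [t u] /=.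
move=> /eqP + /eqP; rewrite !eq_complex /= => /andP[/eqP hp _] /andP[/eqP hr /eqP hs].
have -> : p = 0 by lra.
have -> : t = - r by lra.
have -> : u = s by lra.
by split=> //; apply/eqP; rewrite eq_complex /=; apply/andP; split; apply/eqP; lra.
Qed.

Lemma crdP x y : crd x 0 = crd y 0 -> crd x 1 = crd y 1 ->
  crd x 2%:R = crd y 2%:R -> x = y.
Proof.
have [x1 x2 x3 x4] := su2_entries x; have [y1 y2 y3 y4] := su2_entries y.
move=> e0 e1 e2; apply/val_inj/matrixP => i j.
by case: (ord2_cases i) => ->; case: (ord2_cases j) => ->;
  rewrite ?x1 ?x2 ?x3 ?x4 ?y1 ?y2 ?y3 ?y4 ?e0 ?e1 ?e2.
Qed.

Lemma crd_su2_of v k : crd (su2_of v) k = v 0 k.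
Proof.
by rewrite /crd !mxE; case: k => -[|[|[|//]]] hk /=; congr (v _ _); apply: val_inj.
Qed.

Lemma crd_lie x y :
  (crd (lie x y) 0 = 2 * (crd x 1 * crd y 2%:R - crd x 2%:R * crd y 1)) *
  (crd (lie x y) 1 = 2 * (crd x 2%:R * crd y 0 - crd x 0 * crd y 2%:R)) *
  (crd (lie x y) 2%:R = 2 * (crd x 0 * crd y 1 - crd x 1 * crd y 0)).
Proof.
have [x1 x2 x3 x4] := su2_entries x; have [y1 y2 y3 y4] := su2_entries y.
rewrite ![crd (lie _ _) _]crdE /= !mxE !big_ord_recl !big_ord0 !lift_ord2_0.
by rewrite ?x1 ?x2 ?x3 ?x4 ?y1 ?y2 ?y3 ?y4 /=; split; [split|]; ring.
Qed.

Definition ebas (k : 'I_3) : g := su2_of (delta_mx 0 k).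

Lemma crd_ebas i j : crd (ebas i) j = (j == i)%:R.
Proof. by rewrite crd_su2_of mxE eqxx. Qed.

Lemma su2_decomp x : x = crd x 0 *: ebas 0 + crd x 1 *: ebas 1 + crd x 2%:R *: ebas 2%:R.
Proof. by apply: crdP; rewrite !crdD !crdZ !crd_ebas /=; ring. Qed.

(* The quaternions i and (1 + i + j + k) / 2: conjugation by the first changes the sign of
   two axes, by the second permutes the axes cyclically, which determines an invariant
   form up to a scalar. *)
Definition quat_i : 'M[R[i]]_2 :=
  \matrix_(i, j) if i == 0 then (if j == 0 then Complex 0 1 else 0)
    else (if j == 0 then 0 else Complex 0 (-1)).
Definition quat_c : 'M[R[i]]_2 :=
  \matrix_(i, j) if i == 0 then Complex (2^-1) (2^-1)
    else (if j == 0 then Complex (- 2^-1) (2^-1) else Complex (2^-1) (- 2^-1)).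

(** The classical parametrization of SU(2) by unit quaternions. *)
Lemma SU2P (u : 'M[R[i]]_2) (x y : R[i]) :
  u 0 0 = x -> u 0 1 = y -> u 1 0 = - conjc y -> u 1 1 = conjc x ->
  x * conjc x + y * conjc y = 1 -> u \in @SU2 R.
Proof.
move=> h00 h01 h10 h11 h; rewrite unfold_in; apply/andP; split.
  apply/eqP/matrixP => i j; rewrite !mxE !big_ord_recl big_ord0 !mxE lift_ord2_0.
  by case: (ord2_cases i) => ->; case: (ord2_cases j) => ->; rewrite ?h00 ?h01 ?h10 ?h11
    ?rmorphN /= ?conjcK ?mulr1n ?mulr0n -?h; ring.
rewrite (expand_det_row _ ord0) !big_ord_recl big_ord0 /cofactor !det_mx11 !mxE /=.
rewrite lift_ord2_0.
have -> : lift 1 0 = 0 :> 'I_2 by apply: val_inj.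
by rewrite h00 h01 h10 h11 /bump /= addn0 expr0 expr1; apply/eqP; rewrite -[RHS]h; ring.
Qed.

Lemma quat_i_SU2 : quat_i \in @SU2 R.
Proof.
apply: (SU2P (x := Complex 0 1) (y := 0)); rewrite ?mxE //=;
  apply/eqP; rewrite eq_complex /=; apply/andP; split; apply/eqP; lra.
Qed.

Lemma quat_c_SU2 : quat_c \in @SU2 R.
Proof.
by apply: (SU2P (x := Complex (2^-1) (2^-1)) (y := Complex (2^-1) (2^-1)));
  rewrite ?mxE //=;
  apply/eqP; rewrite eq_complex /=; apply/andP; split; apply/eqP; lra.
Qed.

Lemma crd_Ad_quat_i x :
  (crd (Ad quat_i_SU2 x) 0 = crd x 0) * (crd (Ad quat_i_SU2 x) 1 = - crd x 1) *
  (crd (Ad quat_i_SU2 x) 2%:R = - crd x 2%:R).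
Proof.
have [x1 x2 x3 x4] := su2_entries x.
rewrite ![crd (Ad _ _) _]crdE /= !mxE !big_ord_recl !big_ord0 !mxE.
rewrite !big_ord_recl !big_ord0 !mxE !lift_ord2_0 ?x1 ?x2 ?x3 ?x4 /=.
by split; [split|]; ring.
Qed.

Lemma crd_Ad_quat_c x :
  (crd (Ad quat_c_SU2 x) 0 = crd x 2%:R) * (crd (Ad quat_c_SU2 x) 1 = crd x 0) *
  (crd (Ad quat_c_SU2 x) 2%:R = crd x 1).
Proof.
have [x1 x2 x3 x4] := su2_entries x.
rewrite ![crd (Ad _ _) _]crdE /= !mxE !big_ord_recl !big_ord0 !mxE.
rewrite !big_ord_recl !big_ord0 !mxE !lift_ord2_0 ?x1 ?x2 ?x3 ?x4 /=.
by split; [split|]; field.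
Qed.

Section DotBilinearity.
Variable ip : {dot g for idfun}.

Lemma ipC x y : ip x y = ip y x.
Proof. by rewrite hermC expr0 mul1r. Qed.
Lemma ipDl x y z : ip (x + y) z = ip x z + ip y z.
Proof. exact: linearDl. Qed.
Lemma ipDr x y z : ip z (x + y) = ip z x + ip z y.
Proof. exact: linearD. Qed.
Lemma ipZl r x y : ip (r *: x) y = r * ip x y.
Proof. exact: linearZl_LR. Qed.
Lemma ipZr r x y : ip y (r *: x) = r * ip y x.
Proof. by rewrite ipC ipZl ipC. Qed.
End DotBilinearity.

Lemma Ad_invariant_form (ip : {dot g for idfun}) : Ad_invariant ip ->
  exists2 l : R, 0 < l & forall x y,
    ip x y = l * (crd x 0 * crd y 0 + crd x 1 * crd y 1 + crd x 2%:R * crd y 2%:R).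
Proof.
move=> hip; have sym := ipC ip.
have Ei0 : Ad quat_i_SU2 (ebas 0) = ebas 0.
  by apply: crdP; rewrite ?crdN crd_Ad_quat_i !crd_ebas /= ?oppr0.
have Ei1 : Ad quat_i_SU2 (ebas 1) = - ebas 1.
  by apply: crdP; rewrite ?crdN crd_Ad_quat_i !crd_ebas /= ?oppr0.
have Ec0 : Ad quat_c_SU2 (ebas 0) = ebas 1.
  by apply: crdP; rewrite ?crdN crd_Ad_quat_c !crd_ebas /= ?oppr0.
have Ec1 : Ad quat_c_SU2 (ebas 1) = ebas 2%:R.
  by apply: crdP; rewrite ?crdN crd_Ad_quat_c !crd_ebas /= ?oppr0.
have Ec2 : Ad quat_c_SU2 (ebas 2%:R) = ebas 0.
  by apply: crdP; rewrite ?crdN crd_Ad_quat_c !crd_ebas /= ?oppr0.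
(* Conjugation by [quat_i] fixes one axis and negates the other, so this product equals its
   opposite; the cyclic permutation then carries it to the other two pairs. *)
have o01 : ip (ebas 0) (ebas 1) = 0.
  have := hip _ quat_i_SU2 (ebas 0) (ebas 1); rewrite Ei0 Ei1 linearN /=; lra.
have o12 : ip (ebas 1) (ebas 2%:R) = 0 by rewrite -Ec0 -Ec1 hip.
have o20 : ip (ebas 2%:R) (ebas 0) = 0 by rewrite -Ec1 -Ec2 hip.
have n1 : ip (ebas 1) (ebas 1) = ip (ebas 0) (ebas 0) by rewrite -Ec0 hip.
have n2 : ip (ebas 2%:R) (ebas 2%:R) = ip (ebas 0) (ebas 0) by rewrite -Ec1 hip.
exists (ip (ebas 0) (ebas 0)).
  apply: neq0_dnorm_gt0; apply/eqP => /(congr1 (crd^~ 0)).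
  by rewrite crd_ebas eqxx -(scale0r 0) crdZ mul0r => /eqP; rewrite oner_eq0.
move=> x y; rewrite [x in ip x _]su2_decomp [y in ip _ y]su2_decomp.
rewrite !(ipDl, ipDr, ipZl, ipZr) n1 n2 o01 o12 o20 (sym (ebas 1) (ebas 0)).
by rewrite (sym (ebas 0) (ebas 2%:R)) (sym (ebas 2%:R) (ebas 1)) o01 o12 o20; ring.
Qed.

End Coordinates.

Lemma big_ord3 (V : nmodType) (f : 'I_3 -> V) :
  \sum_(i < 3) f i = f 0 + f 1 + f 2%:R.
Proof.
rewrite !big_ord_recl big_ord0 addr0 addrA.
by congr (f _ + f _ + f _); apply: val_inj.
Qed.

(* Comparing the atoms [crd x k] up to conversion is expensive for ring and field. *)
Ltac gen_crd := repeat match goal with |- context [crd ?x ?k] => move: (crd x k) => ? end.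

Lemma ord3_cases (k : 'I_3) : [\/ k = 0, k = 1 | k = 2%:R].
Proof.
by case: k => -[|[|[|//]]] hk; [constructor 1|constructor 2|constructor 3];
  apply: val_inj.
Qed.

(** * Hamiltonian vectors in the triple coordinates (a, b, c) *)

Section Triples.
Variable R : realType.
Local Notation g := (su2 R).
Implicit Types w z : g3 R.

Definition tri (a b c : g) : g3 R :=
  [ffun k : 'I_3 => if k == 0 then a else if k == 1 then b else c].

Lemma triE a b c : (tri a b c 0 = a) * (tri a b c 1 = b) * (tri a b c 2%:R = c).
Proof. by rewrite !ffunE. Qed.

Lemma triP w z : w 0 = z 0 -> w 1 = z 1 -> w 2%:R = z 2%:R -> w = z.
Proof.
move=> h0 h1 h2; apply/ffunP => -[[|[|[|//]]] hk].
- by have -> : Ordinal hk = 0 by apply: val_inj.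
- by have -> : Ordinal hk = 1 by apply: val_inj.
by have -> : Ordinal hk = 2%:R by apply: val_inj.
Qed.

(** The effect on (a, b, c) of rotating the frame [j] times; index addition is modulo 3. *)
Definition shift3 (j : 'I_3) w : g3 R := [ffun k => w (k + j)].

Lemma shift1E w :
  (shift3 1 w 0 = w 1) * (shift3 1 w 1 = w 2%:R) * (shift3 1 w 2%:R = w 0).
Proof.
rewrite !ffunE add0r; split; [split=> //|]; congr (w _); exact: val_inj.
Qed.

Lemma shift11 w : shift3 1 (shift3 1 w) = shift3 2%:R w.
Proof. by apply/ffunP => k; rewrite !ffunE -addrA. Qed.

Lemma shift21 w : shift3 2%:R (shift3 1 w) = w.
Proof.
apply/ffunP => k; rewrite !ffunE -addrA; congr (w _).
by rewrite [X in k + X](_ : _ = 0) ?addr0 //; apply: val_inj.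
Qed.

Definition lie3 w : g3 R :=
  tri (lie (w 1) (w 2%:R)) (lie (w 2%:R) (w 0)) (lie (w 0) (w 1)).

Lemma lie3_shift1 w : lie3 (shift3 1 w) = shift3 1 (lie3 w).
Proof. by apply: triP; rewrite !(triE, shift1E). Qed.

Variable ip : {dot g for idfun}.

Definition dot3 w z : R := \sum_(k < 3) ip (w k) (z k).

Lemma dot3C w z : dot3 w z = dot3 z w.
Proof. by apply: eq_bigr => k _; rewrite ipC. Qed.

Lemma dot3_linear w : linear (dot3 w : g3 R -> R^o).
Proof.
move=> r x y; rewrite /dot3 !big_ord3 !ffunE !ipDr !ipZr [_ *: _]mulrDr mulrDr.
by rewrite -!addrA; congr (_ + _); ring.
Qed.

Lemma dot3_shift1 w z : dot3 (shift3 1 w) (shift3 1 z) = dot3 w z.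
Proof. by rewrite /dot3 !big_ord3 !shift1E; ring. Qed.

Lemma dot3_eq0 w : dot3 w w = 0 -> w = 0.
Proof.
have ge0 x : 0 <= ip x x.
  by have [->|/neq0_dnorm_gt0/ltW//] := eqVneq x 0; rewrite linear0l.
have eq0 x : ip x x = 0 -> x = 0.
  by move=> h; apply/eqP; apply: contra_eqT h => /neq0_dnorm_gt0 /lt0r_neq0.
move=> /eqP; rewrite psumr_eq0 => [/allP h|k _]; last exact: ge0.
apply/ffunP => k; rewrite ffunE; apply: eq0; apply/eqP.
by apply: (h k); rewrite mem_index_enum.
Qed.

(** The endomorphism representing the symmetric form A through [ip]. *)
Definition A3v w (x : g) : g :=
  (Phi3 ip w)^-1 *: \sum_(k < 3) ip (lie3 w k) x *: lie3 w k.

(* The Hamiltonian vector at w of the covector z, g3 being identified with its dual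
   by dot3. *)
Definition ham w z : g3 R :=
  tri (lie (w 0) (z 0) + lie (w 1) (z 1) + lie (w 2%:R) (z 2%:R))
      (lie (w 1) (z 0) - lie (w 0) (z 1) - A3v w (z 2%:R))
      (lie (w 2%:R) (z 0) - lie (w 0) (z 2%:R) + A3v w (z 1)).

Hypothesis hip : Ad_invariant ip.

Lemma Phi3_shift1 w : Phi3 ip (shift3 1 w) = Phi3 ip w.
Proof.
have [l _ ipE] := Ad_invariant_form hip.
by rewrite /Phi3 !shift1E !ipE !crd_lie; gen_crd; ring.
Qed.

Lemma A3v_sym w x y : ip (A3v w x) y = ip (A3v w y) x.
Proof. by rewrite /A3v !big_ord3 !triE !ipZl !ipDl !ipZl; ring. Qed.

Lemma A3vE w x y : ip (A3v w x) y = A3 ip w x y.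
Proof. by rewrite /A3v /A3 !big_ord3 !triE !ipZl !ipDl !ipZl; ring. Qed.

Lemma ipNl x y : ip (- x) y = - ip x y.
Proof. by rewrite -scaleN1r ipZl mulN1r. Qed.

Lemma crd0 k : crd (0 : g) k = 0.
Proof. by rewrite -(scale0r 0) crdZ mul0r. Qed.

Lemma A3v_linear w : linear (A3v w).
Proof.
move=> r y z; rewrite /A3v !big_ord3 !ipDr !ipZr.
by apply: crdP; rewrite !(crdD, crdZ); gen_crd; ring.
Qed.

(** The bracket terms are skew by invariance of [ip]; A is symmetric but enters the last two
    components with opposite signs. *)
Lemma dot3_ham_skew w z z' : dot3 (ham w z) z' = - dot3 (ham w z') z.
Proof.
rewrite /dot3 !big_ord3 !triE !ipDl !ipNl.
rewrite (A3v_sym w (z' 2%:R)) (A3v_sym w (z' 1)).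
have [l _ ipE] := Ad_invariant_form hip.
move: (ip (A3v _ _) _) (ip (A3v _ _) _) => A1 A2.
by rewrite !ipE !crd_lie; gen_crd; ring.
Qed.

(* The Hamiltonian vectors at w all have this shape, where t and the n's are the trace
   and the antisymmetric part of the matrix of the covector in the basis (a, b, c). *)
Definition leafv w (t n0 n1 n2 : R) : g3 R :=
  let: (u, v, x) := (lie3 w 0, lie3 w 1, lie3 w 2%:R) in
  tri (n0 *: u + n1 *: v + n2 *: x)
      (- n1 *: u + n0 *: v - t *: x)
      (- n2 *: u + t *: v + n0 *: x).

(** Rotating the frame only permutes the parameters up to sign; this is what makes the leaves of the
    three frames agree. *)
Lemma leafv_shift1 w t n0 n1 n2 :
  leafv (shift3 1 w) n2 n0 (- t) (- n1) = shift3 1 (leafv w t n0 n1 n2).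
Proof.
by rewrite /leafv lie3_shift1; apply: triP; rewrite !(triE, shift1E); apply: crdP;
  rewrite !(crdD, crdN, crdZ); gen_crd; ring.
Qed.

Section NonDegenerate.
Variable w : g3 R.
Hypothesis hw : Phi3 ip w != 0.

(** Expansion in (u, v, w), which is [Phi3] times the basis dual to (a, b, c). For instance the
    coefficients of [a, x] are the products of [a, x] with a, b, c over [Phi3]: the first is 0, and
    invariance turns the others into - <x, [a, b]> and <x, [c, a]>. *)
Lemma lie_decomp : [/\
  forall x, lie (w 0) x = (Phi3 ip w)^-1 *:
    (ip x (lie3 w 1) *: lie3 w 2%:R - ip x (lie3 w 2%:R) *: lie3 w 1),
  forall x, lie (w 1) x = (Phi3 ip w)^-1 *:
    (ip x (lie3 w 2%:R) *: lie3 w 0 - ip x (lie3 w 0) *: lie3 w 2%:R)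
  & forall x, lie (w 2%:R) x = (Phi3 ip w)^-1 *:
    (ip x (lie3 w 0) *: lie3 w 1 - ip x (lie3 w 1) *: lie3 w 0)].
Proof.
have [l _ ipE] := Ad_invariant_form hip.
by split=> x; apply: (scalerI hw); rewrite scalerA divff // scale1r /Phi3 !triE;
  apply: crdP; rewrite !(crdD, crdN, crdZ, ipE, crd_lie); gen_crd; ring.
Qed.

Lemma ham_leafv z : exists t n0 n1 n2, ham w z = leafv w t n0 n1 n2.
Proof.
have [L0 L1 L2] := lie_decomp.
(* [N i j] is the coefficient of [z i] on [w j], read off with the dual basis. *)
pose N i j := (Phi3 ip w)^-1 * ip (z i) (lie3 w j).
exists (N 0 0 + N 1 1 + N 2%:R 2%:R), (N 1 2%:R - N 2%:R 1),
  (N 2%:R 0 - N 0 2%:R), (N 0 1 - N 1 0).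
rewrite /N /ham /leafv /A3v !L0 !L1 !L2 !big_ord3 !(ipC ip (lie3 w _)).
move: (lie3 w 0) (lie3 w 1) (lie3 w 2%:R) => u v x.
by apply: triP; rewrite !triE; apply: crdP; rewrite !(crdD, crdN, crdZ); gen_crd; ring.
Qed.

Lemma dot3_lie3 i j : ip (lie3 w i) (w j) = (i == j)%:R * Phi3 ip w.
Proof.
have [l _ ipE] := Ad_invariant_form hip.
by case: (ord3_cases i) => ->; case: (ord3_cases j) => ->;
  rewrite !triE /Phi3 !ipE !crd_lie /=; gen_crd; ring.
Qed.

(** By biorthogonality only the [k]-th term survives, and its factor [Phi3] cancels the
    denominator. *)
Lemma A3v_lie3 k : A3v w (w k) = lie3 w k.
Proof.
rewrite /A3v (bigD1 k) //= big1 ?addr0 => [|i /negPf ik].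
  by rewrite dot3_lie3 eqxx mul1r scalerA mulVf // scale1r.
by rewrite dot3_lie3 ik mul0r scale0r.
Qed.

Lemma A3v0 : A3v w 0 = 0.
Proof. by rewrite /A3v big1 ?scaler0 // => k _; rewrite linear0 scale0r. Qed.

Lemma A3vZ r k : A3v w (r *: w k) = r *: lie3 w k.
Proof. by rewrite -[r *: w k]addr0 A3v_linear A3v0 A3v_lie3 addr0. Qed.

(** Converse of [ham_leafv]: the matrix of this covector has [t] as its only diagonal entry and one
    entry [n0], [n1], [n2] in each antisymmetric pair. Its last two components are multiples of
    single [w k], where A is known. *)
Lemma leafv_ham t n0 n1 n2 : leafv w t n0 n1 n2 =
  ham w (tri (t *: w 0 + n2 *: w 1) (n0 *: w 2%:R) (n1 *: w 0)).
Proof.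
rewrite /ham !triE !A3vZ.
by apply: triP; rewrite !triE; apply: crdP;
  rewrite !(crdD, crdN, crdZ, crd_lie); gen_crd; ring.
Qed.

(** X is the shape [leafv] with [n0] = 1 and the rest 0; the covector is the antisymmetric matrix
    with these parameters. *)
Lemma ham_lie3 : ham w (tri 0 (2^-1 *: w 2%:R) (- 2^-1 *: w 1)) = lie3 w.
Proof.
rewrite /ham !triE ?A3v0 !A3vZ.
by apply: triP; rewrite !triE; apply: crdP;
  rewrite !(crdD, crdN, crdZ, crd0, crd_lie); gen_crd; field.
Qed.

(** The intermediate vector of the metric, obtained from X by the second flat map followed by the
    inverse of the first; it has shape [leafv] with [n1] = 1 and the rest 0. *)
Definition Y3 : g3 R := tri (lie3 w 1) (- lie3 w 0) 0.

Lemma ham_Y3 : ham w (tri (- 2^-1 *: w 2%:R) 0 (2^-1 *: w 0)) = Y3.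
Proof.
rewrite /ham !triE ?A3v0 !A3vZ.
by apply: triP; rewrite !triE; apply: crdP;
  rewrite !(crdD, crdN, crdZ, crd0, crd_lie); gen_crd; field.
Qed.

Lemma dot3_Y : dot3 (tri (- 2^-1 *: w 0) (- 2^-1 *: w 1) 0) (lie3 w) = - Phi3 ip w.
Proof.
have [l _ ipE] := Ad_invariant_form hip.
by rewrite /dot3 big_ord3 !triE /Phi3 !ipE !crdZ !crd_lie !crd0; gen_crd; field.
Qed.

End NonDegenerate.

Lemma ham_shift1 w z : Phi3 ip w != 0 ->
  exists z', ham w z = shift3 2%:R (ham (shift3 1 w) z').
Proof.
move=> hw; have [t [n0 [n1 [n2 ->]]]] := ham_leafv hw z.
have hw1 : Phi3 ip (shift3 1 w) != 0 by rewrite Phi3_shift1.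
(* The covector that [leafv_ham] gives at the rotated triple for the rotated parameters. *)
exists (tri (n2 *: w 1 - n1 *: w 2%:R) (n0 *: w 0) (- t *: w 1)).
have := leafv_ham hw1 n2 n0 (- t) (- n1); rewrite !shift1E scaleNr => <-.
by rewrite leafv_shift1 shift21.
Qed.

(** In the third frame the point is (c, a, b) and the covector (0, - a / 2, - b / 2): a diagonal
    matrix of trace -1, so the vector has shape [leafv] with [t] = -1 and the rest 0. *)
Lemma ham_Y3_shift2 w : Phi3 ip w != 0 ->
  ham (shift3 2%:R w) (shift3 2%:R (tri (- 2^-1 *: w 0) (- 2^-1 *: w 1) 0)) =
  shift3 2%:R (Y3 w).
Proof.
move=> hw.
have hw2 : Phi3 ip (shift3 2%:R w) != 0 by rewrite -shift11 !Phi3_shift1.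
have sE z : (shift3 2%:R z 0 = z 2%:R) *
  (shift3 2%:R z 1 = z 0) * (shift3 2%:R z 2%:R = z 1).
  by rewrite -shift11 !shift1E.
have A0 := A3vZ hw2 (- 2^-1) 1; have A1 := A3vZ hw2 (- 2^-1) 2%:R.
rewrite /ham !(sE, triE) in A0 A1 *; rewrite A0 A1.
by apply: triP; rewrite !(triE, sE); apply: crdP;
  rewrite !(crdD, crdN, crdZ, crd0, crd_lie); gen_crd; field.
Qed.

End Triples.

(** * Bilinear functions as linear maps, and inverses of injective linear maps *)

Lemma linfun2E (R : comNzRingType) (U V W : vectType R) (f : U -> V -> W) u v :
  (forall x, linear (f x)) -> (forall y, linear (f^~ y)) ->
  linfun (fun x => linfun (f x)) u v = f u v.
Proof.
move=> fr fl; rewrite linfunE ?linfunE // => a x y.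
by apply/lfunP => z; rewrite add_lfunE scale_lfunE !linfunE // fl.
Qed.

Lemma lker0_eq0 (K : fieldType) (U V : vectType K) (f : 'Hom(U, V)) :
  (forall u, f u = 0 -> u = 0) -> lker f == 0%VS.
Proof.
move=> f0; apply/eqP/vspaceP => u; rewrite memv_ker memv0.
by apply/eqP/eqP => [/f0|->]; rewrite ?linear0.
Qed.

Lemma lker0_lfunVK (K : fieldType) (U V : vectType K) (f : 'Hom(U, V)) :
  lker f == 0%VS -> dim U = dim V -> cancel f^-1%VF f.
Proof.
move=> f0 dUV v; apply: limg_lfunVK; suff -> : limg f = fullv by rewrite memvf.
apply/eqP; rewrite eqEdim subvf dimvf -dUV limg_dim_eq; first by rewrite dimvf /=.
by rewrite (eqP f0) capv0.
Qed.

(** * Transfer to the space of linear maps: Poisson structure, leaves and symplectic forms *)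

Section PoissonGeometry.
Variable R : realType.
Local Notation g := (su2 R).
Variables ip ipT : {dot g for idfun}.
Hypothesis hip : Ad_invariant ip.

Definition frame (F : 3.-tuple g) :=
  forall i j, ipT (tnth F i) (tnth F j) = (i == j)%:R.

Lemma orthonormal_frame (F : 3.-tuple g) : orthonormal ipT F -> frame F.
Proof.
case: F => -[|f0 [|f1 [|f2 [|//]]]] //= hF.
rewrite /orthonormal /= !andbT => /andP[/and3P[/eqP n0 /eqP n1 /eqP n2]].
rewrite /orthogonal /= ?andbT => /andP[/andP[/eqP h01 /eqP h02] /eqP h12] i j.
by case: (ord3_cases i) => ->; case: (ord3_cases j) => ->;
  rewrite !(tnth_nth 0) /= // ipC.
Qed.

Lemma tnth_rot1 (F : 3.-tuple g) :
  (tnth [tuple of rot 1 F] 0 = tnth F 1) * (tnth [tuple of rot 1 F] 1 = tnth F 2%:R)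
  * (tnth [tuple of rot 1 F] 2%:R = tnth F 0).
Proof. by case: F => -[|f0 [|f1 [|f2 [|//]]]] //= hF; rewrite !(tnth_nth 0). Qed.

Lemma rot11 (F : 3.-tuple g) :
  [tuple of rot 2 F] = [tuple of rot 1 [tuple of rot 1 F]].
Proof. by apply: val_inj; case: F => -[|f0 [|f1 [|f2 [|//]]]]. Qed.

Lemma frame_rot1 (F : 3.-tuple g) : frame F -> frame [tuple of rot 1 F].
Proof.
move=> hF i j; case: (ord3_cases i) => ->; case: (ord3_cases j) => ->;
by rewrite !tnth_rot1 hF.
Qed.

Lemma dim_g3 : dim (g3 R) = 9. Proof. by rewrite /dim /= card_ord. Qed.

Section OneFrame.
Variable F : 3.-tuple g.
Hypothesis hF : frame F.
Local Notation dot := (dot3 ip).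
Implicit Types (p : Mspace R) (a b : dual (Mspace R)).

Lemma PsiVE (w : g3 R) x : PsiV ip F w x = \sum_(k < 3) ip (w k) x *: tnth F k.
Proof.
rewrite /PsiV linfun2E // => [v r y z|y r v v'].
  rewrite scaler_sumr -big_split; apply: eq_bigr => k _ /=.
  by rewrite ipDr ipZr scalerDl scalerA.
rewrite scaler_sumr -big_split; apply: eq_bigr => k _ /=.
by rewrite !ffunE ipDl ipZl scalerDl scalerA.
Qed.

Lemma lker_PsiV : lker (PsiV ip F) == 0%VS.
Proof.
apply: lker0_eq0 => w h.
apply: (@dot3_eq0 _ ip); apply: big1 => k _.
(* Evaluating the zero map at [w k] and pairing with the [k]-th frame vector isolates
   [ip (w k) (w k)]. *)
have := congr1 (ipT^~ (tnth F k)) (congr1 (fun f : Mspace R => f (w k)) h).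
rewrite /= PsiVE zero_lfunE linear0l !big_ord3 !ipDl !ipZl !hF.
by case: (ord3_cases k) => -> /=; rewrite !(mulr0, mulr1, addr0, add0r).
Qed.

Lemma PsiVK : cancel (PsiV ip F) (Psi ip F).
Proof. exact: lker0_lfunK lker_PsiV. Qed.

Lemma PsiK : cancel (Psi ip F) (PsiV ip F).
Proof. by apply: lker0_lfunVK lker_PsiV _; rewrite dim_g3. Qed.

Lemma lcoordE i xi p : lcoord ip F i xi p = ip xi (Psi ip F p i).
Proof.
rewrite /lcoord linfunE // => r x y.
by rewrite linearP !ffunE ipDr ipZr.
Qed.

Lemma covectorE z p : covector ip F z p = dot z (Psi ip F p).
Proof.
rewrite /covector linfunE => [|r x y]; rewrite ?sum_lfunE.
  by apply: eq_bigr => k _; rewrite lcoordE.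
apply/lfunP => q; rewrite add_lfunE scale_lfunE !sum_lfunE scaler_sumr -big_split.
by apply: eq_bigr => k _; rewrite /= !lcoordE !ffunE ipDl ipZl.
Qed.

Lemma covector_PsiV z w : covector ip F z (PsiV ip F w) = dot z w.
Proof. by rewrite covectorE PsiVK. Qed.

Lemma lker_covector : lker (covector ip F) == 0%VS.
Proof.
apply: lker0_eq0 => z h.
by apply: (@dot3_eq0 _ ip); rewrite -covector_PsiV h zero_lfunE.
Qed.

Lemma covectorK : cancel (covector ip F) (covector ip F)^-1%VF.
Proof. exact: lker0_lfunK lker_covector. Qed.

Lemma covectorVK : cancel (covector ip F)^-1%VF (covector ip F).
Proof. by apply: lker0_lfunVK lker_covector _; rewrite dim_g3. Qed.

Lemma poissonE p a b : poisson ip F p a b =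
  dot (ham ip (Psi ip F p) ((covector ip F)^-1%VF a)) ((covector ip F)^-1%VF b).
Proof.
rewrite /poisson; set z := _ a; set z' := _ b; set w := Psi _ _ _.
rewrite /dot3 !big_ord3 /bracket_lcoord /= !lcoordE -/w -!A3vE !triE.
rewrite !ipDl !ipNl.
have [l _ ipE] := Ad_invariant_form hip.
move: (ip (A3v _ _ _) _) (ip (A3v _ _ _) _) => A1 A2.
by rewrite !ipE !crd_lie; gen_crd; ring.
Qed.

Lemma poisson_linear p a : linear (poisson ip F p a : _ -> R^o).
Proof. by move=> r x y; rewrite !poissonE linearP dot3_linear. Qed.

Lemma poisson_skew p a b : poisson ip F p a b = - poisson ip F p b a.
Proof. by rewrite !poissonE dot3_ham_skew. Qed.

Lemma bidual_evE (V : vectType R) (v : V) (a : dual V) : bidual_ev V v a = a v.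
Proof.
rewrite /bidual_ev (linfun2E (f := fun v (a : dual V) => a v)) // => [x r b c|x r b c].
  by rewrite add_lfunE scale_lfunE.
by rewrite linearP.
Qed.

Lemma lker_bidual_ev : lker (bidual_ev (Mspace R)) == 0%VS.
Proof.
apply: lker0_eq0 => v h.
rewrite -[v]PsiK; set w := Psi _ _ _; suff -> : w = 0 by rewrite linear0.
apply: (@dot3_eq0 _ ip); rewrite -covector_PsiV PsiK.
by rewrite -bidual_evE h zero_lfunE.
Qed.

Lemma sharpE p a : sharp ip F p a =
  PsiV ip F (ham ip (Psi ip F p) ((covector ip F)^-1%VF a)).
Proof.
rewrite /sharp comp_lfunE; set v := PsiV _ _ _.
(* Bidual evaluation is injective, so its inverse recovers the vector once the functional is known
   to be evaluation at it. *)
suff -> : linfun (fun a => linfun (poisson ip F p a : dual (Mspace R) -> R^o)) a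
    = bidual_ev _ v by rewrite lker0_lfunK ?lker_bidual_ev.
apply/lfunP => b; rewrite bidual_evE linfun2E => [|x|x r y z].
- by rewrite poissonE -[b in RHS]covectorVK covector_PsiV dot3C.
- exact: poisson_linear.
by rewrite 3!(poisson_skew _ _ x) poisson_linear opprD -scalerN.
Qed.

Lemma sharp_covector p z :
  sharp ip F p (covector ip F z) = PsiV ip F (ham ip (Psi ip F p) z).
Proof. by rewrite sharpE covectorK. Qed.

Lemma sharp_poisson p a b : b (sharp ip F p a) = poisson ip F p a b.
Proof. by rewrite sharpE -[b in LHS]covectorVK covector_PsiV poissonE dot3C. Qed.

(** The inverse picks some preimage; writing [v] as [sharp b], skewness moves [sharp] back onto that
    preimage, so the choice drops out. *)
Lemma sharpV p a v : v \in limg (sharp ip F p) ->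
  (sharp ip F p)^-1%VF (sharp ip F p a) v = a v.
Proof.
case/memv_imgP => b _ ->; rewrite !sharp_poisson poisson_skew -sharp_poisson.
by rewrite limg_lfunVK ?memv_img ?memvf // sharp_poisson -poisson_skew.
Qed.

Lemma omega_flatE p T u v a : vsval u = sharp ip F p a ->
  vsval v \in limg (sharp ip F p) -> omega_flat ip F p T u v = a (vsval v).
Proof.
move=> hu hv; rewrite /omega_flat linfun2E => [|x r y z|x r y z].
- by rewrite hu sharpV.
- by rewrite !linearP.
by rewrite !linearP add_lfunE scale_lfunE.
Qed.

(** Nondegeneracy on the leaf: if [sharp a] pairs to 0 with every [sharp b], skewness shows that
    every covector [b] kills [sharp a]. *)
Lemma lker_omega_flat p : lker (omega_flat ip F p (leafT ip F p)) == 0%VS.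
Proof.
apply: lker0_eq0 => u h.
have /memv_imgP[a _ ua] := subvsP u.
apply: val_inj; rewrite /= ua.
have H b : b (sharp ip F p a) = 0.
  have bT : sharp ip F p b \in leafT ip F p by rewrite memv_img ?memvf.
  have := congr1 (fun f : dual _ => f (vsproj _ (sharp ip F p b))) h.
  rewrite /= (omega_flatE ua) ?vsprojK // zero_lfunE => e.
  by rewrite sharp_poisson poisson_skew -sharp_poisson e oppr0.
apply/eqP; rewrite -memv0 -(eqP lker_bidual_ev) memv_ker; apply/eqP/lfunP => b.
by rewrite bidual_evE H zero_lfunE.
Qed.

Lemma XfieldE p : Xfield ip F p = PsiV ip F (lie3 (Psi ip F p)).
Proof. by []. Qed.

Lemma Xfield_gradient p : is_gradient ip F p (Xfield ip F p).
Proof.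
move=> v; rewrite XfieldE /Mdot PsiVK -/(dot3 ip _ _).
set w := Psi ip F p; set x := Psi ip F v.
have [l _ ipE] := Ad_invariant_form hip.
(* [Phi] is cubic, so along a line it is a polynomial in [t], whose derivative at 0 is the
   coefficient of degree 1. *)
pose q : {poly R} := Poly [:: Phi3 ip w; dot (lie3 w) x; dot (lie3 x) w; Phi3 ip x].
have -> : (fun t : R => Phi ip F (p + t *: v)) = horner q.
  apply: funext => t; rewrite horner_Poly /=.
  rewrite /Phi linearD linearZ -/w -/x /Phi3 /dot3 !big_ord3 !triE !ffunE.
  by rewrite !ipE !crd_lie !crdD !crdZ; gen_crd; ring.
apply: DeriveDef; first exact: derivable_horner.
by rewrite -derive1E -derivE horner_coef0 coef_deriv coef_Poly.
Qed.

End OneFrame.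

(** * Behaviour under rotation of the frame *)

Section Rotation.
Variable F : 3.-tuple g.
Hypothesis hF : frame F.
Implicit Types (w z : g3 R) (p : Mspace R).
Local Notation rF := [tuple of rot 1 F].

Lemma PsiV_rot1 w : PsiV ip rF (shift3 1 w) = PsiV ip F w.
Proof.
apply/lfunP => x; rewrite !PsiVE !big_ord3 !shift1E !tnth_rot1.
by rewrite addrC addrA.
Qed.

Lemma Psi_rot1 p : Psi ip rF p = shift3 1 (Psi ip F p).
Proof. by rewrite -{1}[p](PsiK hF) -PsiV_rot1 (PsiVK (frame_rot1 hF)). Qed.

Lemma covector_rot1 z : covector ip rF (shift3 1 z) = covector ip F z.
Proof.
apply/lfunP => p; rewrite !covectorE Psi_rot1; exact: dot3_shift1.
Qed.

Lemma Phi_rot1 p : Phi ip rF p = Phi ip F p.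
Proof. by rewrite /Phi Psi_rot1 Phi3_shift1. Qed.

Lemma leafT_rot1 p : Phi ip F p != 0 -> (leafT ip F p <= leafT ip rF p)%VS.
Proof.
move=> hp; apply/subvP => _ /memv_imgP[a _ ->].
rewrite -[a](covectorVK hF) sharp_covector //.
have [z ->] := ham_shift1 hip ((covector ip F)^-1%VF a) hp.
rewrite -PsiV_rot1 -Psi_rot1.
suff -> (y : g3 R) : shift3 1 (shift3 2%:R y) = y.
  by rewrite -(sharp_covector (frame_rot1 hF)) memv_img ?memvf.
by rewrite -shift11 -[RHS]shift21 -shift11.
Qed.

End Rotation.

(** * Evaluation of the metric on the gradient field *)

Section Metric.
Variable F : 3.-tuple g.
Hypothesis hF : frame F.
Variable p : Mspace R.
Hypothesis hp : Phi ip F p != 0.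
Local Notation F2 := [tuple of rot 1 F].
Local Notation F3 := [tuple of rot 2 F].
Local Notation w := (Psi ip F p).
Local Notation T := (leafT ip F p).
Local Notation X := (Xfield ip F p).

Let hF2 := frame_rot1 hF.
Let hF3 : frame F3. Proof. by rewrite rot11; do 2!apply: frame_rot1. Qed.

Lemma leafT_rot2 : (T <= leafT ip F3 p)%VS.
Proof.
rewrite rot11; apply: subv_trans (leafT_rot1 hF hp) _.
by apply: leafT_rot1 => //; rewrite Phi_rot1.
Qed.

Lemma Xfield_sharp1 : X =
  sharp ip F p (covector ip F (tri 0 (2^-1 *: w 2%:R) (- 2^-1 *: w 1))).
Proof. by rewrite sharp_covector // ham_lie3. Qed.

Lemma Xfield_leafT : X \in T.
Proof. by rewrite Xfield_sharp1 memv_img ?memvf. Qed.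

Lemma Xfield_rot1 : Xfield ip F2 p = X.
Proof. by rewrite !XfieldE Psi_rot1 // lie3_shift1 PsiV_rot1. Qed.

(** X does not change under rotation, so [ham_lie3] applies in the second frame at (b, c, a), with
    covector (0, a / 2, - c / 2); rotated back, this is the covector displayed. *)
Lemma Xfield_sharp2 : X =
  sharp ip F2 p (covector ip F (tri (- 2^-1 *: w 2%:R) 0 (2^-1 *: w 0))).
Proof.
have hw : Phi3 ip (shift3 1 w) != 0 by rewrite Phi3_shift1.
rewrite -covector_rot1 // sharp_covector // Psi_rot1 //.
rewrite (_ : shift3 1 (tri _ _ _) =
  tri 0 (2^-1 *: shift3 1 w 2%:R) (- 2^-1 *: shift3 1 w 1)).
  by rewrite ham_lie3 // -Psi_rot1 // -XfieldE Xfield_rot1.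
by apply: triP; rewrite !shift1E !triE.
Qed.

Lemma Y3_sharp3 : PsiV ip F (Y3 w) =
  sharp ip F3 p (covector ip F (tri (- 2^-1 *: w 0) (- 2^-1 *: w 1) 0)).
Proof.
rewrite rot11 -(covector_rot1 hF) -(covector_rot1 hF2) sharp_covector;
  last by rewrite -rot11.
rewrite (Psi_rot1 hF2) (Psi_rot1 hF) 2!shift11 (ham_Y3_shift2 hip hp).
by rewrite -shift11 2!PsiV_rot1.
Qed.

Lemma hmetric_Xfield : hmetric ip F p X X = - Phi ip F p.
Proof.
have hX := Xfield_leafT.
set x : subvs_of T := vsproj T X.
have xE : vsval x = X by rewrite vsprojK.
pose a2 := covector ip F (tri (- 2^-1 *: w 2%:R) 0 (2^-1 *: w 0)).
have yE : sharp ip F p a2 = PsiV ip F (Y3 w) by rewrite sharp_covector // ham_Y3.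
have hY : sharp ip F p a2 \in T by rewrite memv_img ?memvf.
pose y := vsproj T (sharp ip F p a2).
have yvE : vsval y = sharp ip F p a2 by rewrite vsprojK.
(* Both functionals are the restriction of [a2] to the leaf, as X and [Y3] are its images under the
   second and first [sharp]. *)
have e : omega_flat ip F2 p T x = omega_flat ip F p T y.
  apply/lfunP => v; rewrite (omega_flatE hF yvE) ?subvsP //.
  have xE2 : vsval x = sharp ip F2 p a2 by rewrite xE; exact: Xfield_sharp2.
  rewrite (omega_flatE hF2 xE2); first reflexivity.
  exact: (subvP (leafT_rot1 hF hp)) (subvsP v).
have {}e := etrans (congr1 (omega_flat ip F p T)^-1%VF e)
  (lker0_lfunK (lker_omega_flat hF p) y).
(* By [e] the inner two maps send [x] to [y]; the third flat map turns [y] into the covector of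
   [Y3_sharp3], to be paired with X. *)
rewrite /hmetric /hflat 2!comp_lfunE -/x.
apply: etrans (congr1 (fun z => omega_flat ip F3 p T z x) e) _.
have yE3 := etrans yvE (etrans yE Y3_sharp3).
rewrite (omega_flatE hF3 yE3); last by rewrite xE; apply: (subvP leafT_rot2).
by rewrite xE XfieldE (covector_PsiV hF) (dot3_Y hip).
Qed.

End Metric.
End PoissonGeometry.

Theorem proposition4p6 (R : realType)
    (ip : {dot su2 R for idfun}) (hip : Ad_invariant ip)
    (ipT : {dot su2 R for idfun})
    (o : 3.-tuple (su2 R)) (ho : basis_of fullv o)
    (F : 3.-tuple (su2 R)) (hF : is_frame ipT o F)
    (p : Mspace R) (hp : Phi ip F p != 0) :
  [/\ is_gradient ip F p (Xfield ip F p),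
      Xfield ip F p \in leafT ip F p
    & hmetric ip F p (Xfield ip F p) (Xfield ip F p) = - Phi ip F p].
Proof.
have [/orthonormal_frame fF _] := hF.
split.
- exact (Xfield_gradient hip fF p).
- exact (Xfield_leafT hip fF hp).
- exact (hmetric_Xfield hip fF hp).
Qed.
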